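(* Let $\mathbb{F}\in\{\mathbb{R},\mathbb{C}\}$, let $A$ be an $n\times m$ matrix over $\mathbb{F}$ and let $r,s\in[1,\infty]$. Then $$\|A\|_{r,s}= m^{[(1/2)-(1/r)]_+}\, n^{[(1/s)-(1/2)]_+}\,\|A\|_{2,2}$$ if and only if $A$ has a singular value decomposition $A=U\Sigma V^*$ (with $U$ an $n\times n$ and $V$ an $m\times m$ unitary matrix over $\mathbb{F}$, i.e. real orthogonal when $\mathbb{F}=\mathbb{R}$, and $\Sigma$ an $n\times m$ nonnegative diagonal matrix) in which (i) the first column of $U$ lies in $K_{\mathrm{sgn}(2-s)}\subset\mathbb{F}^n$, (ii) the first column of $V$ lies in $K_{-\mathrm{sgn}(2-r)}\subset\mathbb{F}^m$, and (iii) the $(1,1)$ entry of $\Sigma$ is its maximal entry.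
   Context: $\|x\|_p$ is the Hölder $\ell_p$ norm; $\|A\|_{p,q}=\max_{x\in\mathbb{F}^m,x\ne0}\|Ax\|_q/\|x\|_p$; for real $A$ one may work over $\mathbb{F}=\mathbb{R}$ or $\mathbb{F}=\mathbb{C}$. $V^*$ is the conjugate transpose. $[z]_+=\max(z,0)$, $\mathrm{sgn}$ is the sign function, $1/\infty=0$. In $\mathbb{F}^k$: $K_1$ = vectors all of whose components have equal absolute values; $K_{-1}$ = vectors with at most one nonzero component; $K_0=\mathbb{F}^k$. *)

(* Defs.v *)
From HB Require Import structures.
From mathcomp Require Import all_boot all_order all_algebra.
From mathcomp Require Import complex spectral.
From mathcomp Require Import all_classical all_reals exp.
Set Implicit Arguments. Unset Strict Implicit. Unset Printing Implicit Defensive.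
Import Order.TTheory GRing.Theory Num.Theory.
Local Open Scope ring_scope.
Local Open Scope complex_scope.

Section Defs.
Variable R : realType.
Local Notation C := R[i].

Definition cabs (z : C) : R := Num.sqrt (complex.Re z ^+ 2 + complex.Im z ^+ 2).

(* The scalar field F: [isreal = true] means F = R (entries with zero
   imaginary part), [isreal = false] means F = C. *)
Definition inF (isreal : bool) (z : C) : Prop := isreal -> complex.Im z = 0.
Definition mxF (isreal : bool) p q (M : 'M[C]_(p, q)) : Prop :=
  forall i j, inF isreal (M i j).

Definition lpnorm (p : \bar R) k (x : 'cV[C]_k) : R :=
  match p with
  | EFin p => (\sum_(i < k) cabs (x i 0) `^ p) `^ p^-1
  | +oo%E => \big[Num.max/0]_(i < k) cabs (x i 0)
  | -oo%E => 0
  end.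

Definition opnorm (isreal : bool) (p q : \bar R) k l (A : 'M[C]_(k, l)) : R :=
  sup [set t : R | exists x : 'cV[C]_l,
        [/\ mxF isreal x, x != 0 & t = lpnorm q (A *m x) / lpnorm p x]].

Definition einv (p : \bar R) : R :=
  match p with EFin p => p^-1 | _ => 0 end.

Definition pospart (z : R) : R := Num.max z 0.

Definition sgn2m (s : \bar R) : int :=
  if (s < 2%:E)%E then 1 else if s == 2%:E then 0 else -1.

Definition nonneg_diag p q (S : 'M[C]_(p, q)) : Prop :=
  forall (i : 'I_p) (j : 'I_q), (0 <= S i j) /\ ((i : nat) != j -> S i j = 0).

Definition K1 k (x : 'cV[C]_k) : Prop := forall i j, `|x i 0| = `|x j 0|.
Definition Km1 k (x : 'cV[C]_k) : Prop :=
  forall i j, x i 0 != 0 -> x j 0 != 0 -> i = j.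
Definition Kset (e : int) k (x : 'cV[C]_k) : Prop :=
  if e == 1 then K1 x else if e == -1 then Km1 x else True.

End Defs.

(* Main.v *)
Require Import Defs.
From HB Require Import structures.
From mathcomp Require Import all_boot all_order all_algebra.
From mathcomp Require Import complex spectral.
From mathcomp Require Import all_classical all_reals exp.
From mathcomp Require Import topology normedtype sequences derive realfun.
From mathcomp Require Import ring lra.
Set Implicit Arguments. Unset Strict Implicit. Unset Printing Implicit Defensive.
Import Order.TTheory GRing.Theory Num.Theory.
Import numFieldNormedType.Exports.
Local Open Scope ring_scope.
Local Open Scope complex_scope.
Local Open Scope sesquilinear_scope.

(* For every [x], writing [alpha] and [beta] for the powers of [n] and [m],
     [|A x|_s <= alpha |A x|_2 <= alpha |A|_(2,2) |x|_2 <= alpha beta |A|_(2,2) |x|_r],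
   where the first and last inequalities are equalities exactly when [A x] and
   [x] lie in the relevant sets [K_e]. The norm [|A|_(r,s)] is attained by
   compactness, so it equals the bound iff some [x] in its set is a top right
   singular vector with [A x] in its set. Such an [x], together with [A x]
   rescaled, is then extended to unitary bases: in these bases [A] is block
   diagonal with corner entry [|A|_(2,2)], because the norm of [A] is attained at
   the first basis vector, and the remaining block is diagonalised by induction. *)

(** * Comparison of power sums and maxima of nonnegative families, with equality cases *)

Section PowerSums.
Context {R : realType}.
Implicit Types (a c p q t : R) (k : nat).

Lemma pow1R p : 1 `^ p = 1 :> R.
Proof. by rewrite powR1. Qed.

(** This is strict weighted AM-GM for [a] and 1. With [L = ln a], both numbers are [expR (t * L)]
    times the exponentials of [(1 - t) * L] and [- t * L]. The strict bound [1 + x < expR x] at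
    these two points, averaged with weights [t] and [1 - t], has cancelling linear terms. *)
Lemma powR_lt_chord t a : 0 < t < 1 -> 0 <= a -> a != 1 -> a `^ t < t * a + (1 - t).
Proof.
move=> /andP[t0 t1]; rewrite le_eqVlt => /predU1P[<- _|a0 a1].
  by rewrite powR0 ?gt_eqF// mulr0 add0r subr_gt0.
have L0 : ln a != 0 by rewrite ln_eq0.
have aE : a = expR (ln a) by rewrite lnK.
have -> : a `^ t = expR (t * ln a) by rewrite /powR gt_eqF.
set L := ln a in L0 aE *.
have h1 : 1 + (1 - t) * L < expR ((1 - t) * L).
  by apply: expR_gt1Dx; rewrite mulf_neq0// subr_eq0 eq_sym lt_eqF.
have h2 : 1 + - t * L < expR (- t * L).
  by apply: expR_gt1Dx; rewrite mulf_neq0// oppr_eq0 gt_eqF.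
have w0 := expR_gt0 (t * L).
have e1 : a = expR (t * L) * expR ((1 - t) * L) by rewrite -expRD aE; congr expR; lra.
have e2 : 1 = expR (t * L) * expR (- t * L) by rewrite -expRD -[LHS]expR0; congr expR; lra.
rewrite {1}e1 [X in _ + X](_ : _ = (1 - t) * (expR (t * L) * expR (- t * L))); last first.
  by rewrite -e2; lra.
have : expR (t * L) * 1 < expR (t * L) * (t * expR ((1 - t) * L) + (1 - t) * expR (- t * L)).
  rewrite ltr_pM2l//.
  have : t * (1 + (1 - t) * L) < t * expR ((1 - t) * L) by rewrite ltr_pM2l.
  have : (1 - t) * (1 + - t * L) < (1 - t) * expR (- t * L) by rewrite ltr_pM2l// subr_gt0.
  lra.
lra.
Qed.

Lemma powR_cancel p a : 0 <= a -> p != 0 -> (a `^ p) `^ p^-1 = a.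
Proof. by move=> a0 p0; rewrite -powRrM divff// powRr1. Qed.

(** The finite case of [lpnorm], on real families, so that the inequalities can be applied to
    families of absolute values. *)
Definition pnorm p k (f : 'I_k -> R) : R := (\sum_(i < k) f i `^ p) `^ p^-1.

Section Pnorm.
Context {k : nat}.
Implicit Types (f : 'I_k -> R).

Lemma sum_powR_ge0 p f : 0 <= \sum_(i < k) f i `^ p.
Proof. by apply: sumr_ge0 => i _; exact: powR_ge0. Qed.

Lemma pnorm_ge0 p f : 0 <= pnorm p f.
Proof. exact: powR_ge0. Qed.

Lemma pnormZ p c f : p != 0 -> 0 <= c -> (forall i, 0 <= f i) ->
  pnorm p (fun i => c * f i) = c * pnorm p f.
Proof.
move=> p0 c0 f0; rewrite /pnorm.
under eq_bigr do rewrite powRM//.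
rewrite -mulr_sumr powRM ?powR_ge0 ?sum_powR_ge0//.
by rewrite -powRrM divff// powRr1.
Qed.

Lemma pnorm_powR p f : p != 0 -> pnorm p f `^ p = \sum_(i < k) f i `^ p.
Proof. by move=> p0; rewrite /pnorm -powRrM mulVf// powRr1// sum_powR_ge0. Qed.

Lemma pnorm_eq0 p f : 0 < p -> pnorm p f = 0 -> forall i, f i = 0.
Proof.
move=> p0 /(congr1 (fun x => x `^ p)).
rewrite pnorm_powR ?gt_eqF// powR0 ?gt_eqF// => /eqP.
rewrite psumr_eq0 => [/allP h i|i _]; last exact: powR_ge0.
by apply: (@powR_eq0_eq0 _ _ p); apply/eqP; apply: h; rewrite mem_index_enum.
Qed.

Lemma pnorm_supp1 p f i0 : 0 < p -> 0 <= f i0 -> (forall i, i != i0 -> f i = 0) ->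
  pnorm p f = f i0.
Proof.
move=> p0 f0 h; rewrite /pnorm (bigD1 i0)//= big1 ?addr0 => [|i /h ->]; last first.
  by rewrite powR0 ?gt_eqF.
by rewrite -powRrM divff ?gt_eqF// powRr1.
Qed.

Lemma pnorm_const p f i0 : 0 < p -> 0 <= f i0 -> (forall i, f i = f i0) ->
  pnorm p f = k%:R `^ p^-1 * f i0.
Proof.
move=> p0 f0 h; rewrite /pnorm; under eq_bigr do rewrite h.
rewrite sumr_const cardT size_enum_ord -[_ `^ p *+ k]mulr_natl powRM ?ler0n ?powR_ge0//.
by rewrite -powRrM divff ?gt_eqF// powRr1.
Qed.

Lemma le_pnorm p f i : 0 < p -> (forall i, 0 <= f i) -> f i <= pnorm p f.
Proof.
move=> p0 f0.
rewrite -[leLHS]powRr1// -(divff (lt0r_neq0 p0)) powRrM.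
apply: ge0_ler_powR; rewrite ?nnegrE ?invr_ge0 ?(ltW p0) ?powR_ge0 ?sum_powR_ge0//.
by rewrite (bigD1 i)//= lerDl; apply: sumr_ge0 => j _; exact: powR_ge0.
Qed.

Lemma pnorm_bigmax_le p f : 0 < p -> (forall i, 0 <= f i) ->
  \big[Num.max/0]_(i < k) f i <= pnorm p f.
Proof.
by move=> p0 f0; apply: bigmax_le => [|i _]; [exact: pnorm_ge0|exact: le_pnorm].
Qed.

(** Dividing by the norm reduces the comparisons of exponents to families whose powers sum to 1. *)
Lemma pnorm_normalize q f : 0 < q -> (forall i, 0 <= f i) -> pnorm q f != 0 ->
  exists b : 'I_k -> R, [/\ forall i, 0 <= b i, forall i, f i = pnorm q f * b i &
    \sum_(i < k) b i `^ q = 1].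
Proof.
move=> q0 f0 N0; exists (fun i => f i / pnorm q f); split.
- by move=> i; rewrite divr_ge0 ?pnorm_ge0.
- by move=> i; rewrite mulrC divfK.
- under eq_bigr do rewrite powRM ?invr_ge0 ?pnorm_ge0//.
  rewrite -mulr_suml -pnorm_powR ?gt_eqF// -powRM ?pnorm_ge0 ?invr_ge0 ?pnorm_ge0//.
  by rewrite divff// powR1.
Qed.

(** After normalisation every [b i] is at most 1, so a larger exponent lowers each power. In the
    equality case each nonzero [b i] equals 1, and two such entries would make the sum of powers
    exceed 1. *)
Lemma pnorm_anti p q f : 0 < p -> p < q -> (forall i, 0 <= f i) ->
  pnorm q f <= pnorm p f /\
  (pnorm q f = pnorm p f -> forall i j, f i != 0 -> f j != 0 -> i = j).
Proof.
move=> p0 pq f0; have q0 : 0 < q by exact: lt_trans pq.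
have [N0|N0] := eqVneq (pnorm q f) 0.
  rewrite N0 pnorm_ge0; split=> // _ i j.
  by rewrite (pnorm_eq0 q0 N0) eqxx.
have [b [b0 fE b1]] := pnorm_normalize q0 f0 N0.
have ble1 i : b i <= 1.
  rewrite leNgt; apply/negP => bi.
  have : 1 < b i `^ q by rewrite -[ltLHS](pow1R q) gt0_ltr_powR ?nnegrE.
  apply/negP; rewrite -leNgt -b1 (bigD1 i)//= lerDl.
  by apply: sumr_ge0 => j _; exact: powR_ge0.
have bpq i : b i `^ q <= b i `^ p.
  have [->|bi] := eqVneq (b i) 0; first by rewrite !powR0 ?gt_eqF.
  by apply: ger_powR (ltW pq); rewrite lt_neqAle eq_sym bi b0 ble1.
have Ngt0 : 0 < pnorm q f by rewrite lt_neqAle eq_sym N0 pnorm_ge0.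
have pE : pnorm p f = pnorm q f * pnorm p b.
  rewrite -(pnormZ (lt0r_neq0 p0) (pnorm_ge0 q f) b0); congr pnorm; exact/funext.
have S1 : 1 <= \sum_(i < k) b i `^ p by rewrite -b1; apply: ler_sum.
split.
  rewrite pE -[leLHS]mulr1 (ler_pM2l Ngt0) -[leLHS](pow1R p^-1).
  by apply: ge0_ler_powR; rewrite ?nnegrE ?invr_ge0 ?(ltW p0) ?ler01 ?(le_trans ler01 S1).
rewrite pE -[LHS]mulr1 => /(mulfI N0) /(congr1 (fun x => x `^ p)).
rewrite pnorm_powR ?gt_eqF// powR1 -b1 => /eqP.
rewrite -subr_eq0 -sumrB -oppr_eq0 -sumrN psumr_eq0; last first.
  by move=> i _; rewrite oppr_ge0 subr_le0.
move=> /allP h.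
(* Equal powers for two distinct exponents force [ln (b i) = 0], as [b i] is positive. *)
have bE i : f i != 0 -> b i = 1.
  move=> fi; have bi : b i != 0 by apply: contra_neq fi => bi; rewrite fE bi mulr0.
  have := h i; rewrite mem_index_enum => /(_ isT); rewrite oppr_eq0 subr_eq0 /powR (negPf bi).
  move=> /eqP/expR_inj /eqP; rewrite -subr_eq0 -mulrBl mulf_eq0 subr_eq0 gt_eqF//=.
  by rewrite ln_eq0 ?lt_neqAle 1?eq_sym ?bi ?b0// => /eqP.
move=> i j fi fj; apply/eqP/negPn/negP => ij.
have : 1 < \sum_(i < k) b i `^ q.
  rewrite (bigD1 i)//= (bigD1 j)/=; last by rewrite eq_sym.
  rewrite (bE i)// (bE j)// !powR1 ltrDl.
  by apply: ltr_wpDr ltr01; apply: sumr_ge0 => ? _; exact: powR_ge0.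
by rewrite b1 ltxx.
Qed.

(** The power-mean inequality. The [k] rescaled powers [y i] have mean 1, so the chord bounds sum to
    [k]; their strictness makes every [y i] equal to 1 in the equality case. *)
Lemma pnorm_mean p q f : 0 < p -> p < q -> (forall i, 0 <= f i) ->
  pnorm p f <= k%:R `^ (p^-1 - q^-1) * pnorm q f /\
  (pnorm p f = k%:R `^ (p^-1 - q^-1) * pnorm q f -> forall i j, f i = f j).
Proof.
move=> p0 pq f0; have q0 : 0 < q by exact: lt_trans pq.
have [N0|N0] := eqVneq (pnorm q f) 0.
  have fz := pnorm_eq0 q0 N0; split=> [|_ i j]; last by rewrite !fz.
  rewrite N0 mulr0 /pnorm big1 ?powR0 ?invr_eq0 ?gt_eqF// => i _.
  by rewrite fz powR0 ?gt_eqF.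
have k0 : (0 < k%:R :> R).
  rewrite ltr0n lt0n; apply: contra_neq N0 => k0; rewrite /pnorm big1 ?powR0 ?invr_eq0 ?gt_eqF//.
  by move=> i; have := ltn_ord i; rewrite [X in (_ < X)%N]k0.
have [b [b0 fE b1]] := pnorm_normalize q0 f0 N0.
have Ngt0 : 0 < pnorm q f by rewrite lt_neqAle eq_sym N0 pnorm_ge0.
(* With this exponent the [t]-th power of [y i] is a fixed multiple of the [p]-th power of [b i]. *)
pose t := p / q; have t01 : 0 < t < 1 by rewrite divr_gt0//= ltr_pdivrMr ?mul1r.
pose y i := k%:R * b i `^ q.
have y0 i : 0 <= y i by rewrite mulr_ge0 ?powR_ge0 ?ltW.
have yt i : y i `^ t <= t * y i + (1 - t).
  by have [->|yi] := eqVneq (y i) 1; [rewrite powR1; lra|apply/ltW/powR_lt_chord].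
have ytE i : y i `^ t = k%:R `^ t * b i `^ p.
  by rewrite powRM ?powR_ge0 ?ltW// -powRrM /t [q * _]mulrC divfK ?gt_eqF.
have yS : \sum_(i < k) (t * y i + (1 - t)) = k%:R.
  rewrite big_split/= -mulr_sumr -mulr_sumr b1 sumr_const cardT size_enum_ord -mulr_natr; lra.
have S1 : k%:R `^ t * \sum_(i < k) b i `^ p <= k%:R.
  by rewrite -[leRHS]yS mulr_sumr; apply: ler_sum => i _; rewrite -ytE.
have pE : pnorm p f = pnorm q f * pnorm p b.
  rewrite -(pnormZ (lt0r_neq0 p0) (pnorm_ge0 q f) b0); congr pnorm; exact/funext.
have bS : pnorm p b `^ p = \sum_(i < k) b i `^ p by rewrite pnorm_powR ?gt_eqF.
(* The constant of the claim, raised to the power [p], is the one that [S1] provides. *)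
have kE : (k%:R `^ (p^-1 - q^-1)) `^ p = k%:R / k%:R `^ t :> R.
  rewrite -powRrM mulrBl mulVf ?gt_eqF// [q^-1 * p]mulrC powRB ?powRr1 ?ler0n//.
  by apply/implyP => _; rewrite gt_eqF.
rewrite pE [X in _ <= X]mulrC; split.
  rewrite ler_pM2l// -[leRHS](powR_cancel _ (lt0r_neq0 p0)) ?powR_ge0// kE.
  have kt : 0 < k%:R `^ t :> R by rewrite powR_gt0.
  apply: ge0_ler_powR; rewrite ?nnegrE ?invr_ge0 ?(ltW p0) ?sum_powR_ge0
    ?divr_ge0 ?powR_ge0 ?ler0n//.
  by rewrite ler_pdivlMr// mulrC.
rewrite [X in _ = X]mulrC => /(mulfI N0) /(congr1 (fun x => x `^ p)).
rewrite bS kE => bE.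
(* Equality makes the nonnegative gaps in the chord bounds sum to zero, so each of them vanishes. *)
have /eqP : \sum_(i < k) (t * y i + (1 - t) - y i `^ t) = 0.
  rewrite sumrB yS; under eq_bigr do rewrite ytE.
  by rewrite -mulr_sumr bE mulrC divfK ?subrr// gt_eqF// powR_gt0.
rewrite psumr_eq0 => [/allP h|i _]; last by rewrite subr_ge0.
have yE i : y i = 1.
  apply/eqP; apply: contraT => yi.
  have := powR_lt_chord t01 (y0 i) yi.
  by have := h i; rewrite mem_index_enum => /(_ isT); rewrite subr_eq0 => /eqP ->; rewrite ltxx.
move=> i j; rewrite !fE; congr (_ * _).
apply: (powR_injective q0); rewrite ?nnegrE//.
by apply: (mulfI (lt0r_neq0 k0)); rewrite -/(y i) -/(y j) !yE.
Qed.

(** The maximum is one of the entries; in the equality case the powers of the other entries sum to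
    zero. *)
Lemma bigmax_le_pnorm q f : 0 < q -> (forall i, 0 <= f i) ->
  \big[Num.max/0]_(i < k) f i <= pnorm q f /\
  (\big[Num.max/0]_(i < k) f i = pnorm q f -> forall i j, f i != 0 -> f j != 0 -> i = j).
Proof.
move=> q0 f0; split; first exact: pnorm_bigmax_le.
set M := \big[_/_]_(i < k) f i => ME i j fi fj.
have fM l : f l <= M by exact: le_bigmax.
have M0 : 0 <= M by exact: le_trans (fM i).
have [l [_ Ml]] : exists l, true /\ M = f l.
  exists [arg max_(l > i) f l]%O; split=> //; apply/eqP; rewrite eq_le fM andbT.
  by case: arg_maxP => // l _ lm; apply: bigmax_le => // l' _; exact: lm.
have := pnorm_powR f (lt0r_neq0 q0); rewrite -ME Ml (bigD1 l)//= => /eqP.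
rewrite eq_sym -subr_eq0 addrAC subrr add0r psumr_eq0 => [/allP h|? _]; last exact: powR_ge0.
have hl x : f x != 0 -> x = l.
  move=> fx; apply/eqP; apply: contraT => xl.
  by have := h x; rewrite mem_index_enum xl => /(_ isT); rewrite powR_eq0 (negPf fx).
by rewrite (hl i)// (hl j).
Qed.

(** The right-hand side is the [q]-norm of a constant family that dominates [f] term by term, and
    equality of the sums forces equality of all terms. *)
Lemma pnorm_le_bigmax q f : 0 < q -> (forall i, 0 <= f i) ->
  pnorm q f <= k%:R `^ q^-1 * \big[Num.max/0]_(i < k) f i /\
  (pnorm q f = k%:R `^ q^-1 * \big[Num.max/0]_(i < k) f i -> forall i j, f i = f j).
Proof.
move=> q0 f0; set M := \big[_/_]_(i < k) f i.
have fM l : f l <= M by exact: le_bigmax.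
have M0 : 0 <= M by exact: bigmax_ge_id.
have kE : k%:R `^ q^-1 * M = (\sum_(i < k) M `^ q) `^ q^-1.
  rewrite sumr_const cardT size_enum_ord -[_ `^ q *+ k]mulr_natl powRM ?ler0n ?powR_ge0//.
  by rewrite -powRrM divff ?gt_eqF// powRr1.
have fMq l : f l `^ q <= M `^ q by apply: ge0_ler_powR; rewrite ?nnegrE ?(ltW q0).
rewrite kE; split.
  apply: ge0_ler_powR; rewrite ?nnegrE ?invr_ge0 ?(ltW q0) ?sum_powR_ge0//.
  by apply: ler_sum.
have qi : 0 < q^-1 by rewrite invr_gt0.
move=> /(powR_injective qi); rewrite !nnegrE => /(_ (sum_powR_ge0 _ _)).
move=> /(_ (sumr_ge0 _ (fun _ _ => powR_ge0 _ _))) /eqP.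
rewrite eq_sym -subr_eq0 -sumrB psumr_eq0 => [/allP h|i _]; last by rewrite subr_ge0.
suff fE l : f l = M by move=> i j; rewrite !fE.
apply: (powR_injective q0); rewrite ?nnegrE//; apply/esym/eqP.
by rewrite -subr_eq0; apply: h; rewrite mem_index_enum.
Qed.

End Pnorm.
End PowerSums.

(** * Hölder norms compared with the Euclidean norm *)

Section LpNorm.
Context {R : realType}.
Local Notation C := R[i].

Lemma cabs_ge0 (z : C) : 0 <= cabs z.
Proof. exact: sqrtr_ge0. Qed.

Lemma cabsE (z : C) : `|z| = (cabs z)%:C.
Proof. exact: normc_def. Qed.

Lemma cabs_eq0 (z : C) : (cabs z == 0) = (z == 0).
Proof. by rewrite -[RHS]normr_eq0 cabsE -(inj_eq (@complexI R)). Qed.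

Lemma cabs0 : cabs (0 : C) = 0.
Proof. by apply/eqP; rewrite cabs_eq0. Qed.

Context {k : nat}.
Implicit Types (x : 'cV[C]_k) (s : \bar R).
Local Notation l2 := (lpnorm 2%:E).

Lemma K1_cabs x : K1 x <-> forall i j, cabs (x i 0) = cabs (x j 0).
Proof.
split=> h i j; last by rewrite !cabsE (h i j).
by apply: complexI; rewrite -!cabsE; exact: h.
Qed.

Lemma Km1_cabs x :
  Km1 x <-> forall i j, cabs (x i 0) != 0 -> cabs (x j 0) != 0 -> i = j.
Proof. by split=> h i j; have := h i j; rewrite !cabs_eq0. Qed.

Lemma lpnorm_ge0 s x : 0 <= lpnorm s x.
Proof. by case: s => [s||]//=; [exact: powR_ge0|exact: bigmax_ge_id]. Qed.

Lemma lpnorm0 s : (0 < s)%E -> lpnorm s (0 : 'cV[C]_k) = 0.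
Proof.
case: s => [s||]//= s0.
  by rewrite big1 ?powR0 ?invr_eq0 ?gt_eqF// => i _; rewrite mxE cabs0 powR0 ?gt_eqF.
apply/le_anti/andP; split; last exact: bigmax_ge_id.
by apply: bigmax_le => // i _; rewrite mxE cabs0.
Qed.

Lemma lpnorm_eq0 s x : (0 < s)%E -> lpnorm s x = 0 -> x = 0.
Proof.
move=> s0 h; apply/colP => i; rewrite mxE; apply/eqP; rewrite -cabs_eq0; apply/eqP.
case: s s0 h => [s||]//=; first by rewrite lte_fin => s0 /(pnorm_eq0 s0); exact.
move=> _ h; apply/le_anti; rewrite cabs_ge0 andbT -h.
exact: (@le_bigmax _ _ _ 0 (fun i => cabs (x i 0))).
Qed.

Lemma lpnorm_gt0 s x : (0 < s)%E -> x != 0 -> 0 < lpnorm s x.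
Proof.
move=> s0 x0; rewrite lt_neqAle lpnorm_ge0 andbT eq_sym.
by apply: contra_neq x0 => /lpnorm_eq0; exact.
Qed.

Lemma lpnorm_Km1 s x : (0 < s)%E -> Km1 x -> lpnorm s x = l2 x.
Proof.
move=> s0 /Km1_cabs h.
have [->|] := eqVneq x 0; first by rewrite !lpnorm0// lte_fin.
case/cV0Pn => i; rewrite -cabs_eq0 => xi.
have hi j : j != i -> cabs (x j 0) = 0.
  by apply: contraNeq => xj; rewrite (h _ _ xj xi).
rewrite [RHS](pnorm_supp1 _ (cabs_ge0 _) hi)//; case: s s0 => [s||]//= s0.
  by rewrite [LHS](pnorm_supp1 _ (cabs_ge0 _) hi).
apply/le_anti/andP; split; last exact: (@le_bigmax _ _ _ 0 (fun i => cabs (x i 0))).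
apply: bigmax_le => [|j _]; first exact: cabs_ge0.
by have [->//|/hi ->] := eqVneq j i; rewrite cabs_ge0.
Qed.

(** The norm is the common absolute value times the dimension to the power [einv s], and [einv]
    vanishing at infinity covers the maximum. The factor is the quotient of two such formulas. *)
Lemma lpnorm_K1 s x : (0 < s)%E -> K1 x -> lpnorm s x = k%:R `^ (einv s - 2^-1) * l2 x.
Proof.
move=> s0 /K1_cabs h.
have [->|] := eqVneq x 0; first by rewrite !lpnorm0// ?lte_fin// mulr0.
case/cV0Pn => i _.
have k0 : k%:R != 0 :> R by rewrite pnatr_eq0 -lt0n (leq_trans _ (ltn_ord i)).
rewrite [l2 x](pnorm_const _ (cabs_ge0 _) (h^~ i))// mulrA -powRD ?k0 ?implybT//.
rewrite subrK; case: s s0 => [s||]//= s0.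
  by rewrite [LHS](pnorm_const _ (cabs_ge0 _) (h^~ i)).
rewrite powRr0 mul1r; apply/le_anti/andP; split; last first.
  exact: (@le_bigmax _ _ _ 0 (fun i => cabs (x i 0))).
by apply: bigmax_le => [|j _]; rewrite ?cabs_ge0// (h j i).
Qed.

(** For [s < 2] this is the power-mean inequality, for [s > 2] monotonicity in the exponent with
    factor 1, and for [s = 2] both sides agree; [pospart] and [sgn2m] encode this split. *)
Lemma lpnorm_le_l2 s x : (1 <= s)%E ->
  lpnorm s x <= k%:R `^ pospart (einv s - 2^-1) * l2 x /\
  (lpnorm s x = k%:R `^ pospart (einv s - 2^-1) * l2 x <-> Kset (sgn2m s) x).
Proof.
move=> s1; have s0 : (0 < s)%E by exact: lt_le_trans s1.
have c0 i : 0 <= cabs (x i 0) by exact: cabs_ge0.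
have [s2|s2|s2] := ltgtP s 2%:E; rewrite /Kset /sgn2m ?s2 ?ltxx ?eqxx/=.
- case: s s1 s0 s2 => [s||]//; rewrite !lee_fin !lte_fin /= => s1 s0 s2.
  have -> : pospart (s^-1 - 2^-1) = s^-1 - 2^-1.
    by apply/max_idPl; rewrite subr_ge0 lef_pV2 ?posrE ?ltr0n// ltW.
  have [h1 h2] := pnorm_mean s0 s2 c0; split; first exact: h1.
  split=> [/h2|] h; first exact/K1_cabs.
  exact: (@lpnorm_K1 s%:E).
- have -> : pospart (einv s - 2^-1) = 0.
    apply/max_idPr; rewrite subr_le0; case: s s1 s0 s2 => [s||]//= _ s0 s2; last first.
      by rewrite invr_ge0.
    by rewrite lef_pV2 ?posrE ?ltr0n// ltW.
  rewrite powRr0 mul1r ltNge (ltW s2) (gt_eqF s2)/=.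
  suff [h1 h2] : lpnorm s x <= l2 x /\ (lpnorm s x = l2 x -> Km1 x).
    by split=> //; split=> // h; exact: lpnorm_Km1.
  case: s s1 s0 s2 => [s||]// _ s0 s2.
    by have [h1 h2] := pnorm_anti (ltr0n R 2) s2 c0; split=> // /h2 h; exact/Km1_cabs.
  by have [h1 h2] := bigmax_le_pnorm (ltr0n R 2) c0; split=> // /h2 h; exact/Km1_cabs.
- by rewrite subrr /pospart maxxx powRr0 mul1r.
Qed.

(** The same comparison with the roles of [s] and 2 exchanged, whence the change of sign in
    [- sgn2m s]. *)
Lemma l2_le_lpnorm s x : (1 <= s)%E ->
  l2 x <= k%:R `^ pospart (2^-1 - einv s) * lpnorm s x /\
  (l2 x = k%:R `^ pospart (2^-1 - einv s) * lpnorm s x <-> Kset (- sgn2m s) x).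
Proof.
move=> s1; have s0 : (0 < s)%E by exact: lt_le_trans s1.
have c0 i : 0 <= cabs (x i 0) by exact: cabs_ge0.
have [s2|s2|s2] := ltgtP s 2%:E; rewrite /Kset /sgn2m ?s2 ?ltxx ?eqxx/=.
- have -> : pospart (2^-1 - einv s) = 0.
    apply/max_idPr; rewrite subr_le0; case: s s1 s0 s2 => [s||]//= _ s0 s2.
    by rewrite lef_pV2 ?posrE ?ltr0n// ltW.
  rewrite powRr0 mul1r; suff [h1 h2] : l2 x <= lpnorm s x /\ (l2 x = lpnorm s x -> Km1 x).
    by split=> //; split=> // h; rewrite (lpnorm_Km1 s0).
  case: s s1 s0 s2 => [s||]// _ s0 s2.
  by have [h1 h2] := pnorm_anti s0 s2 c0; split=> // /h2 h; exact/Km1_cabs.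
- have -> : pospart (2^-1 - einv s) = 2^-1 - einv s.
    apply/max_idPl; rewrite subr_ge0; case: s s1 s0 s2 => [s||]//= _ s0 s2; last first.
      by rewrite invr_ge0.
    by rewrite lef_pV2 ?posrE ?ltr0n// ltW.
  rewrite ltNge (ltW s2) (gt_eqF s2)/=.
  suff [h1 h2] : l2 x <= k%:R `^ (2^-1 - einv s) * lpnorm s x /\
      (l2 x = k%:R `^ (2^-1 - einv s) * lpnorm s x -> K1 x).
    (* On a vector of [K1] the factor given by [lpnorm_K1] is the inverse of the claimed one. *)
    split=> //; split=> // h; rewrite -[LHS]/(l2 x) (lpnorm_K1 s0)// mulrA.
    have [->|] := eqVneq x 0; first by rewrite lpnorm0 ?lte_fin// mulr0.
    case/cV0Pn => i _.
    have k0 : k%:R != 0 :> R by rewrite pnatr_eq0 -lt0n (leq_trans _ (ltn_ord i)).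
    by rewrite -powRD ?k0 ?implybT// addrC addrA subrK subrr powRr0 mul1r.
  case: s s1 s0 s2 => [s||]// _ s0 s2.
    by have [h1 h2] := pnorm_mean (ltr0n R 2) s2 c0; split=> // /h2 h; exact/K1_cabs.
  rewrite subr0; have [h1 h2] := pnorm_le_bigmax (ltr0n R 2) c0.
  by split=> // /h2 h; exact/K1_cabs.
- by rewrite subrr /pospart maxxx powRr0 mul1r.
Qed.

End LpNorm.

(** * Continuity of the norms, and attainment of operator norms by compactness *)

Section OperatorNorm.
Context {R : realType}.
Local Notation C := R[i].

Section Limits.
Local Open Scope classical_set_scope.
Context {T : Type} {F : set_system T} {FF : Filter F}.

Lemma cvg_sum_ord k (g : 'I_k -> T -> R) (l : 'I_k -> R) :
  (forall i, g i z @[z --> F] --> l i) ->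
  (\sum_(i < k) g i z) @[z --> F] --> \sum_(i < k) l i.
Proof.
move=> gl; elim: (index_enum _) => [|i r IH].
  by under eq_fun do rewrite big_nil; rewrite big_nil; exact: cvg_cst.
by under eq_fun do rewrite big_cons; rewrite big_cons; exact: cvgD.
Qed.

Lemma cvg_maxr (f g : T -> R) (a b : R) :
  f z @[z --> F] --> a -> g z @[z --> F] --> b ->
  Num.max (f z) (g z) @[z --> F] --> Num.max a b.
Proof.
move=> fa gb.
have -> : (fun z => Num.max (f z) (g z)) = (fun z => (f z + g z + `|f z - g z|) / 2).
  by apply/funext => z; rewrite maxr_absE.
rewrite maxr_absE; apply: cvgMr_tmp; apply: cvgD; first exact: cvgD.
by apply: cvg_norm; exact: cvgB.
Qed.

Lemma cvg_bigmax_ord k (g : 'I_k -> T -> R) (l : 'I_k -> R) :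
  (forall i, g i z @[z --> F] --> l i) ->
  (\big[Num.max/0]_(i < k) g i z) @[z --> F] --> \big[Num.max/0]_(i < k) l i.
Proof.
move=> gl; elim: (index_enum _) => [|i r IH].
  by under eq_fun do rewrite big_nil; rewrite big_nil; exact: cvg_cst.
under eq_fun do rewrite big_cons; rewrite big_cons.
exact: cvg_maxr.
Qed.

(** At a positive limit the power function is differentiable, hence continuous. At limit 0 the
    estimate is direct: [g z] below [e] to the power [p^-1] has its [p]-th power below [e]. *)
Lemma cvg_powR (g : T -> R) (l p : R) : 0 < p -> (forall z, 0 <= g z) -> 0 <= l ->
  g z @[z --> F] --> l -> (g z `^ p) @[z --> F] --> l `^ p.
Proof.
move=> p0 g0; rewrite le_eqVlt => /predU1P[<-|l0] gl.
  rewrite powR0 ?gt_eqF//; apply/cvgr0Pnorm_lt => e e0.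
  have e0' : 0 < e `^ p^-1 by exact: powR_gt0.
  have /cvgr0Pnorm_lt/(_ _ e0') := gl.
  apply: filterS => z; rewrite !ger0_norm ?powR_ge0// => h.
  rewrite -[ltRHS]powRr1 ?(ltW e0)// -(mulVf (lt0r_neq0 p0)) powRrM.
  by rewrite gt0_ltr_powR ?nnegrE ?powR_ge0.
have c : {for l, continuous (fun a : R => a `^ p)}.
  apply: differentiable_continuous; apply/derivable1_diffP.
  by apply: derivable_powR; rewrite in_itv/= l0.
exact: cvg_comp gl c.
Qed.

Lemma cvg_lpnorm k s (x : T -> 'cV[C]_k) (y : 'cV[C]_k) : (0 < s)%E ->
  (forall i, cabs (x z i 0) @[z --> F] --> cabs (y i 0)) ->
  lpnorm s (x z) @[z --> F] --> lpnorm s y.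
Proof.
case: s => [s||]// s0 xy /=; last exact: cvg_bigmax_ord.
have sum0 (u : 'cV[C]_k) : 0 <= \sum_(i < k) cabs (u i 0) `^ s.
  by apply: sumr_ge0 => i _; exact: powR_ge0.
apply: cvg_powR => //; first by rewrite invr_gt0.
by apply: cvg_sum_ord => i; apply: cvg_powR => //= *; exact: cabs_ge0.
Qed.

Lemma cvg_cabs (f : T -> C) (c : C) :
  complex.Re (f z) @[z --> F] --> complex.Re c ->
  complex.Im (f z) @[z --> F] --> complex.Im c ->
  cabs (f z) @[z --> F] --> cabs c.
Proof.
move=> hr hi; rewrite /cabs.
apply: (@cvg_comp _ _ _ _ (@Num.sqrt R) F (nbhs (complex.Re c ^+ 2 + complex.Im c ^+ 2))).
  by apply: cvgD; rewrite expr2; under eq_fun do rewrite expr2; exact: cvgM.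
exact: sqrt_continuous.
Qed.

End Limits.

Lemma cabsM (a b : C) : cabs (a * b) = cabs a * cabs b.
Proof. by apply: complexI; rewrite -cabsE normrM !cabsE rmorphM. Qed.

Lemma cabs_real (a : R) : cabs a%:C = `|a|.
Proof. by rewrite /cabs/= expr0n addr0 sqrtr_sqr. Qed.

Lemma lpnormZ k s (c : C) (x : 'cV[C]_k) : (0 < s)%E ->
  lpnorm s (c *: x) = cabs c * lpnorm s x.
Proof.
move=> s0; have h i : cabs ((c *: x) i 0) = cabs c * cabs (x i 0) by rewrite mxE cabsM.
case: s s0 => [s||]//= s0; under eq_bigr do rewrite h.
  by rewrite lte_fin in s0; exact: (pnormZ (lt0r_neq0 s0) (cabs_ge0 c) (fun i => cabs_ge0 (x i 0))).
symmetry; apply: (big_morph (fun t => cabs c * t)); last exact: mulr0.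
by move=> a b; rewrite maxr_pMr ?cabs_ge0.
Qed.

(** Real coordinates for complex vectors, so that compactness and continuity are those of real row
    vectors. *)
Definition cvec l (y : 'rV[R]_(l + l)) : 'cV[C]_l :=
  \col_j (y 0 (lshift l j) +i* y 0 (rshift l j)).

Section Attained.
Local Open Scope classical_set_scope.
Context {k l : nat} (b : bool) (p q : \bar R) (A : 'M[C]_(k, l)).
Hypotheses (l0 : (0 < l)%N) (p0 : (0 < p)%E) (q0 : (0 < q)%E).

(* The right half of [y] carries the imaginary parts; the last condition makes
   [cvec y] real when [b = true]. *)
Let K : set 'rV[R]_(l + l) :=
  [set y | \sum_(i < l + l) y 0 i ^+ 2 = 1 /\
           \sum_(j < l) b%:R * y 0 (rshift l j) ^+ 2 = 0].

Let coord i (y : 'rV[R]_(l + l)) : (fun y' : 'rV[R]_(l + l) => y' 0 i) @ y --> y 0 i.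
Proof. exact: (@coord_continuous R 1 (l + l) 0 i y). Qed.

Let coord2 i (y : 'rV[R]_(l + l)) : (fun y' : 'rV[R]_(l + l) => y' 0 i ^+ 2) @ y --> y 0 i ^+ 2.
Proof. exact: (cvgM (@coord i y) (@coord i y)). Qed.

(** The sphere equation puts [K] inside a cube, and both equations define preimages of closed sets
    under continuous maps. *)
Let K_compact : compact K.
Proof.
have cube := @rV_compact R (l + l) (fun=> `[-1, 1]%classic) (fun=> @segment_compact _ _ _).
apply: subclosed_compact cube _; last first.
  move=> y [y1 _] i; rewrite /= in_itv/= -ler_norml -(@expr_le1 _ 2)// real_normK ?num_real//.
  by rewrite -y1 (bigD1 i)//= lerDl; apply: sumr_ge0 => j _; exact: sqr_ge0.
apply: closedI.
  apply: (@preimage_closed _ _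
      (fun y : 'rV[R]_(l + l) => \sum_(i < l + l) y 0 i ^+ 2) [set x | x = 1]).
    by move=> y _; apply: (cvg_sum_ord (F := nbhs y)) => i; exact: (@coord2 _ y).
  exact: closed_eq.
apply: (@preimage_closed _ _
    (fun y : 'rV[R]_(l + l) => \sum_(j < l) b%:R * y 0 (rshift l j) ^+ 2) [set x | x = 0]).
  by move=> y _; apply: (cvg_sum_ord (F := nbhs y)) => i; apply: cvgMl_tmp; exact: (@coord2 _ y).
exact: closed_eq.
Qed.

Let K_cvec y : K y -> mxF b (cvec y) /\ cvec y != 0.
Proof.
move=> [y1 y2]; split.
  move=> j j' bT; rewrite mxE/=; move: y2; rewrite bT => /eqP.
  rewrite psumr_eq0 => [/allP/(_ j)|? _]; last by rewrite mul1r sqr_ge0.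
  by rewrite mem_index_enum mul1r sqrf_eq0 => /(_ isT)/eqP.
apply/negP => /eqP y0; move/eqP: y1; rewrite big_split_ord/= !big1 ?addr0 1?eq_sym ?oner_eq0//.
  by move=> j _; have := congr1 (fun x : 'cV[C]_l => complex.Im (x j 0)) y0;
  rewrite !mxE/= => ->; rewrite expr0n.
by move=> j _; have := congr1 (fun x : 'cV[C]_l => complex.Re (x j 0)) y0;
  rewrite !mxE/= => ->; rewrite expr0n.
Qed.

(** The vector is divided by its Euclidean norm [N], which also serves as the scalar [c]. *)
Let cvec_K (x : 'cV[C]_l) : mxF b x -> x != 0 ->
  exists c y, [/\ c != 0, x = c *: cvec y & K y].
Proof.
move=> xF x0.
pose N := Num.sqrt (\sum_(j < l) (complex.Re (x j 0) ^+ 2 + complex.Im (x j 0) ^+ 2)).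
have S0 : 0 <= \sum_(j < l) (complex.Re (x j 0) ^+ 2 + complex.Im (x j 0) ^+ 2).
  by apply: sumr_ge0 => j _; rewrite addr_ge0 ?sqr_ge0.
have N0 : N != 0.
  apply: contra_neq x0 => /eqP; rewrite sqrtr_eq0 => S1.
  have /eqP : \sum_(j < l) (complex.Re (x j 0) ^+ 2 + complex.Im (x j 0) ^+ 2) = 0.
    by apply/le_anti; rewrite S0 S1.
  rewrite psumr_eq0 => [/allP h|j _]; last by rewrite addr_ge0 ?sqr_ge0.
  apply/colP => j; have := h j; rewrite mem_index_enum => /(_ isT).
  rewrite paddr_eq0 ?sqr_ge0// !sqrf_eq0 => /andP[/eqP r /eqP i].
  by apply/eqP; rewrite mxE eq_complex r i/= eqxx.
exists N%:C, (\row_i match fintype.split i with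
  | inl j => complex.Re (x j 0) / N | inr j => complex.Im (x j 0) / N end).
have eL j : fintype.split (lshift l j) = inl j by exact: (unsplitK (inl _)).
have eR j : fintype.split (rshift l j) = inr j by exact: (unsplitK (inr _)).
split.
- by rewrite -(inj_eq (@complexI R)) in N0.
- apply/colP => j; rewrite !mxE eL eR; apply/eqP; rewrite eq_complex/=.
  by rewrite !mul0r subr0 addr0 ![N * _]mulrC !divfK ?eqxx.
- split; last first.
    apply: big1 => j _; rewrite !mxE eR; case: (b) (xF j 0) => [/(_ isT) ->|_]; rewrite ?mul0r//.
    by rewrite expr0n mulr0.
  rewrite big_split_ord/= -big_split/=.
  under eq_bigr do rewrite !mxE eL eR !expr_div_n -mulrDl.
  by rewrite -mulr_suml sqr_sqrtr// divff// -(sqr_sqrtr S0) sqrf_eq0.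
Qed.

(** The quotient of norms is invariant under scaling, so all its values occur on the compact set
    [K], where it is continuous and has a maximiser. The supremum in [opnorm] is therefore a
    maximum. *)
Lemma opnorm_attained :
  (exists x, [/\ mxF b x, x != 0 & lpnorm q (A *m x) = opnorm b p q A * lpnorm p x]) /\
  (forall x, mxF b x -> lpnorm q (A *m x) <= opnorm b p q A * lpnorm p x).
Proof.
pose f y := lpnorm q (A *m cvec y) / lpnorm p (cvec y).
have fK y : K y -> {for y, continuous f}.
  move=> /K_cvec[_ y0].
  have cnum : (fun z => lpnorm q (A *m cvec z)) @ y --> lpnorm q (A *m cvec y).
    apply: (cvg_lpnorm (F := nbhs y)) => // i; apply: (cvg_cabs (F := nbhs y)).
      under eq_fun do rewrite mxE raddf_sum; rewrite mxE raddf_sum.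
      apply: (cvg_sum_ord (F := nbhs y)) => j; under eq_fun do rewrite !mxE/=; rewrite !mxE/=.
      by case: (A i j) => u v/=; apply: cvgB; apply: cvgMl_tmp; exact: (@coord _ y).
    under eq_fun do rewrite mxE raddf_sum; rewrite mxE raddf_sum.
    apply: (cvg_sum_ord (F := nbhs y)) => j; under eq_fun do rewrite !mxE/=; rewrite !mxE/=.
    by case: (A i j) => u v/=; apply: cvgD; apply: cvgMl_tmp; exact: (@coord _ y).
  have cden : (fun z => lpnorm p (cvec z)) @ y --> lpnorm p (cvec y).
    apply: (cvg_lpnorm (F := nbhs y)) => // i; apply: (cvg_cabs (F := nbhs y)).
      by under eq_fun do rewrite !mxE/=; rewrite !mxE/=; exact: (@coord _ y).
    by under eq_fun do rewrite !mxE/=; rewrite !mxE/=; exact: (@coord _ y).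
  by apply: cvgM cnum (cvgV _ cden); rewrite gt_eqF// lpnorm_gt0.
have fE x : mxF b x -> x != 0 -> exists2 y, K y & f y = lpnorm q (A *m x) / lpnorm p x.
  move=> xF /(cvec_K xF)[c [y [c0 -> Ky]]]; exists y => //.
  rewrite -scalemxAr !lpnormZ// /f invfM mulrACA divff ?mul1r// cabs_eq0//.
(* Positivity of [l] enters here: the all-ones vector yields a point of [K]. *)
have K0 : K !=set0.
  have [||y Ky _] := fE (const_mx 1); last by exists y.
    by move=> i j _; rewrite mxE.
  by apply/cV0Pn; exists (Ordinal l0); rewrite mxE oner_eq0.
have [|y /set_mem Ky ymax] := compact_EVT_max K0 K_compact (f := f).
  by apply: continuous_in_subspaceT => y /set_mem; exact: fK.
have fmax x : mxF b x -> x != 0 -> lpnorm q (A *m x) / lpnorm p x <= f y.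
  by move=> xF /(fE _ xF)[z Kz <-]; apply: ymax; exact: mem_set.
have [yF y0] := K_cvec Ky.
(* The supremum is meaningful because the set of quotients contains [f y] and is bounded by it. *)
have -> : opnorm b p q A = f y.
  apply/le_anti/andP; split.
    by apply: ge_sup => [|_ [x [xF x0 ->]]]; [exists (f y), (cvec y)|exact: fmax].
  apply: ub_le_sup; first by exists (f y) => _ [x [xF x0 ->]]; exact: fmax.
  by exists (cvec y).
split=> [|x xF].
  by exists (cvec y); split=> //; rewrite divfK// gt_eqF// lpnorm_gt0.
have [->|x0] := eqVneq x 0; first by rewrite mulmx0 !lpnorm0// mulr0.
by rewrite -ler_pdivrMr ?lpnorm_gt0//; exact: fmax.
Qed.

End Attained.
End OperatorNorm.

(** * Stability of the scalar field under matrix operations *)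

Section EntriesInF.
Context {R : realType} (b : bool).
Local Notation C := R[i].
Implicit Types x y : C.

Lemma inF_real (a : R) : inF b a%:C. Proof. by []. Qed.

Lemma inFD x y : inF b x -> inF b y -> inF b (x + y).
Proof. by move=> hx hy bT; rewrite raddfD/= hx// hy// addr0. Qed.

Lemma inFN x : inF b x -> inF b (- x).
Proof. by move=> hx bT; rewrite raddfN/= hx// oppr0. Qed.

Lemma inFM x y : inF b x -> inF b y -> inF b (x * y).
Proof.
move=> hx hy bT; case: x y hx hy => [a a'] [c c'] /(_ bT)/= -> /(_ bT)/= ->.
by rewrite mulr0 mul0r addr0.
Qed.

Lemma inF_conj x : inF b x -> inF b x^*.
Proof. by move=> hx bT; case: x hx => a a' /(_ bT)/= ->; rewrite oppr0. Qed.

Lemma inFV x : inF b x -> inF b x^-1.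
Proof. by move=> hx bT; case: x hx => a a' /(_ bT)/= ->; rewrite mul0r oppr0. Qed.

Lemma inF_sum I (r : seq I) (P : pred I) (f : I -> C) :
  (forall i, P i -> inF b (f i)) -> inF b (\sum_(i <- r | P i) f i).
Proof. by move=> h; elim/big_ind: _ => //; exact: inFD. Qed.

Context {k l : nat}.
Implicit Types M N : 'M[C]_(k, l).

Lemma mxFD M N : mxF b M -> mxF b N -> mxF b (M + N).
Proof. by move=> hM hN i j; rewrite mxE; apply: inFD. Qed.

Lemma mxFN M : mxF b M -> mxF b (- M).
Proof. by move=> hM i j; rewrite mxE; apply: inFN. Qed.

Lemma mxFZ c M : inF b c -> mxF b M -> mxF b (c *: M).
Proof. by move=> hc hM i j; rewrite mxE; apply: inFM. Qed.

Lemma mxF_adj M : mxF b M -> mxF b (M ^t*).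
Proof. by move=> hM i j; rewrite !mxE; apply: inF_conj. Qed.

Lemma mxF_scalar c : inF b c -> mxF b (c%:M : 'M[C]_k).
Proof. by move=> hc i j; rewrite mxE; case: eqP. Qed.

Lemma mxF_delta i j : mxF b (delta_mx i j : 'M[C]_(k, l)).
Proof. by move=> i' j'; rewrite mxE; case: (_ && _). Qed.

Lemma mxF_col j M : mxF b M -> mxF b (col j M).
Proof. by move=> hM i j'; rewrite mxE. Qed.

Lemma mxFM m M (N : 'M[C]_(l, m)) : mxF b M -> mxF b N -> mxF b (M *m N).
Proof. by move=> hM hN i j; rewrite mxE; apply: inF_sum => h _; apply: inFM. Qed.

End EntriesInF.

(** * The Euclidean norm and its unitary invariance *)

Section EuclideanNorm.
Context {R : realType}.
Local Notation C := R[i].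
Local Notation l2 := (lpnorm (2%:E : \bar R)).

Lemma l2_sqr k (x : 'cV[C]_k) : l2 x ^+ 2 = \sum_(i < k) cabs (x i 0) ^+ 2.
Proof.
rewrite /= powR12_sqrt ?sum_powR_ge0// sqr_sqrtr ?sum_powR_ge0//.
by apply: eq_bigr => i _; rewrite powR_mulrn// cabs_ge0.
Qed.

Lemma dotmx_l2 k (x : 'cV[C]_k) : x ^t* *m x = ((l2 x ^+ 2)%:C)%:M.
Proof.
apply/matrixP => i j; rewrite !ord1 l2_sqr !mxE eqxx mulr1n rmorph_sum/=.
by apply: eq_bigr => h _; rewrite !mxE rmorphXn/= -cabsE normCKC.
Qed.

Lemma eq_l2 k m (x : 'cV[C]_k) (y : 'cV[C]_m) : x ^t* *m x = y ^t* *m y -> l2 x = l2 y.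
Proof.
rewrite !dotmx_l2 => /matrixP/(_ 0 0); rewrite !mxE eqxx !mulr1n => /complexI.
by move/eqP; rewrite eqrXn2 ?lpnorm_ge0// => /eqP.
Qed.

Lemma adjmxK k m (M : 'M[C]_(k, m)) : (M ^t*) ^t* = M.
Proof. by apply/matrixP => i j; rewrite !mxE conjCK. Qed.

Lemma unitarymx_mulVmx k (U : 'M[C]_k) : U \is unitarymx -> U ^t* *m U = 1%:M.
Proof. by move/unitarymxP/mulmx1C. Qed.

Lemma l2_unitary k (U : 'M[C]_k) (x : 'cV[C]_k) : U \is unitarymx -> l2 (U *m x) = l2 x.
Proof.
move=> Uu; apply: eq_l2; rewrite trmx_mul map_mxM/= mulmxA -[X in X *m _]mulmxA.
by rewrite unitarymx_mulVmx// mulmx1.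
Qed.

Lemma l2_delta k (i : 'I_k) : l2 (delta_mx i 0 : 'cV[C]_k) = 1.
Proof.
apply/eqP; rewrite -(@eqrXn2 _ 2) ?lpnorm_ge0// l2_sqr expr1n (bigD1 i)//= big1.
  by rewrite mxE !eqxx addr0 -(rmorph1 (real_complex R)) cabs_real normr1 expr1n.
by move=> j ji; rewrite mxE (negPf ji) cabs0 expr0n.
Qed.

Lemma l2_col_unitary k (U : 'M[C]_k) j : U \is unitarymx -> l2 (col j U) = 1.
Proof. by move=> Uu; rewrite colE l2_unitary// l2_delta. Qed.

Lemma cabs_le_l2 k (x : 'cV[C]_k) i : cabs (x i 0) <= l2 x.
Proof. exact: (@le_pnorm R k 2 (fun i => cabs (x i 0)) i (ltr0n _ _) (fun i => cabs_ge0 _)). Qed.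

Lemma l2_col_mx k m (x : 'cV[C]_k) (y : 'cV[C]_m) :
  l2 (col_mx x y) ^+ 2 = l2 x ^+ 2 + l2 y ^+ 2.
Proof.
rewrite !l2_sqr big_split_ord/=; congr (_ + _); apply: eq_bigr => i _;
by rewrite (col_mxEu, col_mxEd).
Qed.

End EuclideanNorm.

(** * Unitary completion, singular value decompositions and top singular vectors *)

Section Completion.
Context {R : realType} (b : bool).
Local Notation C := R[i].
Local Notation l2 := (lpnorm (2%:E : \bar R)).

(* A Householder reflection, up to a phase [a] making the first entry of
   [a^* v] nonnegative. When [t = 0] the vector [w] vanishes and [t^-1 = 0], so
   the formula remains valid. *)
Lemma unitary_completion k (v : 'cV[C]_k.+1) : mxF b v -> l2 v = 1 ->
  exists U : 'M[C]_k.+1, [/\ mxF b U, U \is unitarymx & col 0 U = v].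
Proof.
move=> vF v1; set z := v 0 0; have zF : inF b z by exact: vF.
have normF : inF b (`|z|) by rewrite cabsE.
pose a : C := if z == 0 then 1 else z / `|z|.
have aF : inF b a by rewrite /a; case: eqP => _ //; apply: inFM => //; exact: inFV.
have aa : a * a^*%R = 1.
  rewrite -normCK /a; case: eqVneq => [_|z0]; first by rewrite normr1 expr1n.
  by rewrite normrM normfV normr_id divff ?expr1n// normr_eq0.
have az : a^*%R * z = `|z|.
  rewrite /a; case: eqVneq => [->|z0]; first by rewrite mulr0 normr0.
  rewrite rmorphM fmorphV/= (conj_Creal (normr_real z)) mulrAC -normCKC expr2.
  by rewrite mulfK// normr_eq0.
pose e : 'cV[C]_k.+1 := delta_mx 0 0.
pose y := a^*%R *: v; pose w := y - e; pose t : C := 1 - `|z|.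
have yy : y ^t* *m y = 1%:M.
  have na : cabs a^*%R = 1.
    apply: complexI; rewrite -cabsE norm_conjC; apply/eqP.
    by rewrite -(@pexpr_eq1 _ _ 2)// normCK aa.
  by rewrite dotmx_l2 /y lpnormZ ?lte_fin// na v1 mulr1 expr1n.
have ee : e ^t* *m e = 1%:M by rewrite dotmx_l2 l2_delta expr1n.
have ey : e ^t* *m y = (`|z|)%:M.
  rewrite /e trmx_delta map_delta_mx -rowE; apply/rowP => i.
  by rewrite !ord1 !mxE eqxx mulr1n.
have ye : y ^t* *m e = (`|z|)%:M.
  rewrite -[LHS](adjmxK) trmx_mul map_mxM/= adjmxK ey tr_scalar_mx map_scalar_mx/=.
  by rewrite (conj_Creal (normr_real z)).
have adjB (p q : nat) (M N : 'M[C]_(p, q)) : (M - N) ^t* = M ^t* - N ^t*.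
  by rewrite linearB/= map_mxB.
have ww : w ^t* *m w = (t + t)%:M.
  rewrite /w adjB mulmxBr !mulmxBl yy ee ey ye -!raddfB/=; congr (_%:M).
  rewrite /t; ring.
have we : w ^t* *m e = (- t)%:M.
  by rewrite /w adjB mulmxBl ye ee -raddfB/= /t opprB.
have tR : t^*%R = t by rewrite /t rmorphB rmorph1/= (conj_Creal (normr_real z)).
(* By [ww] the squared length of [w] is [t + t], so for nonzero [t] this is the usual reflection in
   the hyperplane orthogonal to [w]. *)
pose H : 'M[C]_k.+1 := 1%:M - t^-1 *: (w *m w ^t*).
have adjwH : (w *m w ^t*) ^t* = w *m w ^t*.
  by rewrite trmx_mul map_mxM/= adjmxK.
have HH : H ^t* = H.
  rewrite /H adjB trmx1 map_mx1 linearZ/= map_mxZ adjwH fmorphV/= tR //.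
have wF : mxF b w.
  by apply: mxFD; [apply: mxFZ => //; exact: inF_conj|apply: mxFN; exact: mxF_delta].
exists (a *: H); split.
- apply: mxFZ => //; apply: mxFD; first exact: mxF_scalar.
  apply: mxFN; apply: mxFZ; last by apply: mxFM => //; exact: mxF_adj.
  by apply: inFV; apply: inFD => //; exact: inFN.
(* As [H] is Hermitian and [a] has modulus 1, unitarity amounts to [H] being an involution. *)
- apply/unitarymxP; rewrite linearZ/= map_mxZ HH -scalemxAl -scalemxAr scalerA aa scale1r.
  rewrite /H mulmxBl mul1mx mulmxBr mulmx1 -scalemxAl -scalemxAr scalerA.
  rewrite mulmxA -[w *m _ *m w]mulmxA ww mul_mx_scalar -scalemxAl scalerA.
  have [->|t0] := eqVneq t 0; first by rewrite invr0 !mul0r !scale0r !subr0.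
  rewrite mulrDr -!mulrA mulVf// !mulr1 scalerDl opprB addrA.
  by rewrite addrA subrK addrK.
- rewrite colE -scalemxAl -/e.
  (* By [we], the reflection sends [e] to [e + w], which is [y]; the phase [a] then restores [v]. *)
  have -> : H *m e = y.
    rewrite /H mulmxBl mul1mx -scalemxAl -mulmxA we mul_mx_scalar scalerA.
    have [t0|t0] := eqVneq t 0.
      have w0 : w = 0.
        apply: (@lpnorm_eq0 _ _ 2%:E); first by rewrite lte_fin.
        have := ww; rewrite dotmx_l2 t0 addr0 => /matrixP/(_ 0 0).
        rewrite !mxE eqxx !mulr1n => /complexI/eqP; rewrite sqrf_eq0 => /eqP; exact.
      by rewrite w0 scaler0 subr0; apply/esym/eqP; rewrite -subr_eq0 -/w w0.
    by rewrite mulrN mulVf// scaleN1r opprK /w addrC subrK.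
  by rewrite /y scalerA aa scale1r.
Qed.

Definition svd_of k l (A : 'M[C]_(k, l)) (U : 'M[C]_k) (S : 'M[C]_(k, l)) (V : 'M[C]_l) : Prop :=
  [/\ mxF b U, mxF b V, U \is unitarymx & V \is unitarymx] /\
  nonneg_diag S /\ A = U *m S *m V ^t*.

(** The diagonal of [S] comes in no particular order; maximality of the corner entry is handled
    separately. *)
Definition has_svd k l (A : 'M[C]_(k, l)) : Prop := exists U S V, svd_of A U S V.

Lemma unitary_block k (U : 'M[C]_k) : U \is unitarymx ->
  block_mx 1%:M 0 0 U \is @unitarymx C (1 + k) (1 + k).
Proof.
move=> /unitarymxP Uu; apply/unitarymxP.
rewrite tr_block_mx map_block_mx !trmx0 !map_mx0 trmx1 map_mx1 mulmx_block.
by rewrite !mulmx0 !mul0mx mulmx1 Uu !addr0 add0r -scalar_mx_block.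
Qed.

Lemma mxF_block k l (M : 'M[C]_(k, l)) c : inF b c -> mxF b M ->
  mxF b (block_mx c%:M 0 0 M : 'M[C]_(1 + k, 1 + l)).
Proof.
move=> cF MF i j; case: (split_ordP i) => i' ->; case: (split_ordP j) => j' ->.
- by rewrite block_mxEul; apply: mxF_scalar.
- by rewrite block_mxEur mxE.
- by rewrite block_mxEdl mxE.
- by rewrite block_mxEdr.
Qed.

Lemma nonneg_diag_block k l (S : 'M[C]_(k, l)) (a : R) : 0 <= a -> nonneg_diag S ->
  nonneg_diag (block_mx a%:C%:M 0 0 S : 'M[C]_(1 + k, 1 + l)).
Proof.
move=> a0 Sd i j; case: (split_ordP i) => i' ->; case: (split_ordP j) => j' ->.
- by rewrite block_mxEul !ord1 mxE eqxx mulr1n ler0c.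
- by rewrite block_mxEur mxE.
- by rewrite block_mxEdl mxE.
- by rewrite block_mxEdr /= !add1n eqSS; exact: Sd.
Qed.

(** A decomposition of the lower block extends to the whole matrix by unit corners in the two
    unitary factors. *)
Lemma block_mx_svd k l (U : 'M[C]_k) (S : 'M[C]_(k, l)) (V : 'M[C]_l) (a : 'M[C]_1) :
  block_mx a 0 0 (U *m S *m V ^t*) =
  (block_mx 1%:M 0 0 U : 'M_(1 + k)) *m block_mx a 0 0 S *m (block_mx 1%:M 0 0 V) ^t*.
Proof.
rewrite tr_block_mx map_block_mx !trmx0 !map_mx0 trmx1 map_mx1 !mulmx_block.
by rewrite !mulmx0 !mul0mx !mulmx1 !mul1mx !addr0 !add0r mul0mx.
Qed.

(** In unitary bases starting with [u] and [v], the first column of the matrix is [sigma] times the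
    first basis vector. The norm bound then kills the rest of the first row, and the remaining block
    is decomposed by hypothesis. *)
Lemma svd_step k l (A : 'M[C]_(k.+1, l.+1)) u v (sigma : R) :
  (forall A' : 'M[C]_(k, l), mxF b A' -> has_svd A') ->
  mxF b A -> mxF b u -> mxF b v -> l2 u = 1 -> l2 v = 1 -> 0 <= sigma ->
  A *m v = sigma%:C *: u ->
  (forall x, mxF b x -> l2 (A *m x) <= sigma * l2 x) ->
  exists U S V, [/\ svd_of A U S V, col 0 U = u, col 0 V = v & S 0 0 = sigma%:C].
Proof.
move=> IH AF uF vF u1 v1 s0 Av Amax.
have [U [UF Uu Uc]] := unitary_completion uF u1.
have [V [VF Vu Vc]] := unitary_completion vF v1.
pose B : 'M[C]_(1 + k, 1 + l) := U ^t* *m A *m V.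
have BF : mxF b B by apply: mxFM => //; apply: mxFM => //; exact: mxF_adj.
have UVB : U *m B *m V ^t* = A.
  by rewrite /B !mulmxA mulmxtVK// (unitarymxP Uu) mul1mx.
have Bmax (x : 'cV[C]_(1 + l)) : mxF b x -> l2 (B *m x) <= sigma * l2 x.
  move=> xF; rewrite /B -!mulmxA l2_unitary ?trmxC_unitary// -(l2_unitary x Vu).
  by apply: Amax; exact: mxFM.
have B0 : B *m delta_mx 0 0 = sigma%:C *: (delta_mx 0 0 : 'cV_(1 + k)).
  rewrite /B -!mulmxA -[V *m _]colE Vc Av -scalemxAr -Uc colE mulmxA.
  by rewrite unitarymx_mulVmx// mul1mx.
clearbody B.
have z0 m : lshift m (0 : 'I_1) = (0 : 'I_(1 + m)) by exact: val_inj.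
have Bl i : B i 0 = sigma%:C * (i == 0)%:R.
  by have := congr1 (fun M : 'cV_(1 + k) => M i 0) B0; rewrite -colE !mxE eqxx andbT.
have Bul : ulsubmx B = sigma%:C%:M.
  by apply/matrixP => i j; rewrite !ord1 !mxE !z0 Bl eqxx mulr1.
have Bdl : dlsubmx B = 0.
  by apply/matrixP => i j; rewrite !ord1 !mxE !z0 Bl mulr0.
pose c := ursubmx B.
have c0 : c = 0.
  (* The test vector is the conjugated first row of [B]. The first entry of [B *m x] is the squared
     length of [x], whereas the bound allows at most [sigma] times that length. *)
  pose x : 'cV[C]_(1 + l) := col_mx sigma%:C%:M (c ^t*).
  pose N := l2 (c ^t*).
  have s1 : l2 (sigma%:C%:M : 'cV[C]_1) = sigma.
    apply/eqP; rewrite -(@eqrXn2 _ 2) ?lpnorm_ge0// l2_sqr big_ord1 mxE eqxx mulr1n.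
    by rewrite cabs_real ger0_norm.
  have xF : mxF b x.
    move=> i j; case: (split_ordP i) => i' ->; rewrite (col_mxEu, col_mxEd).
      exact: mxF_scalar.
    by apply: mxF_adj => i1 j1; rewrite !mxE; exact: BF.
  have xl2 : l2 x ^+ 2 = sigma ^+ 2 + N ^+ 2 by rewrite l2_col_mx s1.
  have Bx : cabs ((B *m x) 0 0) = sigma ^+ 2 + N ^+ 2.
    have -> : (B *m x) 0 0 = usubmx (B *m x) 0 0 by rewrite !mxE z0.
    have -> : usubmx (B *m x) = ((sigma ^+ 2 + N ^+ 2)%:C)%:M.
      have cc : c *m c ^t* = ((N ^+ 2)%:C)%:M by rewrite -{1}(adjmxK c) dotmx_l2.
      rewrite -(submxK B) mul_block_col col_mxKu Bul -/c cc.
      by rewrite -scalar_mxM -raddfD/= -rmorphM -rmorphD expr2.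
    by rewrite mxE eqxx mulr1n cabs_real ger0_norm// addr_ge0 ?sqr_ge0.
  have h : sigma ^+ 2 + N ^+ 2 <= sigma * l2 x.
    rewrite -Bx; apply: le_trans (Bmax _ xF); exact: (cabs_le_l2 (B *m x)).
  have N0 : N = 0.
    have L0 : 0 <= l2 x by exact: lpnorm_ge0.
    have N00 : 0 <= N by exact: lpnorm_ge0.
    clear Bx; clearbody N; move: (l2 x) xl2 h L0 => L e h L0.
    (* Since [L ^ 2] is at most [sigma * L], one of these cases holds, and each forces [N] to
       vanish. *)
    have {h} : L <= sigma \/ L = 0.
      have [->|Ln] := eqVneq L 0; [by right|left].
      by move: h; rewrite -e expr2 ler_pM2r// lt_neqAle eq_sym Ln.
    case=> [Ls|L1]; apply/eqP; rewrite -sqrf_eq0 eq_le sqr_ge0 andbT.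
      by rewrite -(lerD2l (sigma ^+ 2)) addr0 -e ler_sqr.
    by have := sqr_ge0 sigma; move: e; rewrite L1 expr0n/=; lra.
  by rewrite -(adjmxK c) (lpnorm_eq0 _ N0) ?lte_fin// trmx0 map_mx0.
have BE : B = block_mx sigma%:C%:M 0 0 (drsubmx B).
  by rewrite -[LHS]submxK Bul Bdl -/c c0.
have [|U' [S' [V' [[U'F V'F U'u V'u] [S'd S'E]]]]] := IH (drsubmx B).
  by move=> i j; rewrite !mxE; exact: BF.
exists (U *m (block_mx 1%:M 0 0 U' : 'M[C]_(1 + k))),
  (block_mx sigma%:C%:M 0 0 S' : 'M[C]_(1 + k, 1 + l)),
  (V *m (block_mx 1%:M 0 0 V' : 'M[C]_(1 + l))).
(* The block factors fix the first basis vector, so the first columns remain [u] and [v]. *)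
have Dc p (M : 'M[C]_p) : col 0 (block_mx 1%:M 0 0 M : 'M[C]_(1 + p)) = delta_mx 0 0.
  have -> : col 0 (block_mx 1%:M 0 0 M : 'M[C]_(1 + p)) = lsubmx (block_mx 1%:M 0 0 M).
    by apply/matrixP => i j; rewrite !ord1 [LHS]mxE [RHS]mxE z0.
  rewrite block_mxEh row_mxKl; apply/matrixP => i j; rewrite !ord1.
  by case: (split_ordP i) => i' ->; rewrite (col_mxEu, col_mxEd) !mxE ?ord1 ?z0 ?eqxx.
split.
- split.
    split; first by apply: mxFM => //; apply: mxF_block.
    + by apply: mxFM => //; apply: mxF_block.
    + by apply: mul_unitarymx => //; exact: unitary_block.
    + by apply: mul_unitarymx => //; exact: unitary_block.
  split.
    exact: nonneg_diag_block.
  rewrite -UVB BE S'E block_mx_svd trmx_mul map_mxM/=.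
  by rewrite !mulmxA.
- by rewrite colE -mulmxA -colE Dc -colE.
- by rewrite colE -mulmxA -colE Dc -colE.
- transitivity (ulsubmx (block_mx sigma%:C%:M 0 0 S' : 'M[C]_(1 + k, 1 + l)) 0 0).
    by rewrite [RHS]mxE [RHS]mxE !z0.
  by rewrite block_mxKul mxE eqxx mulr1n.
Qed.

(** The maximiser is rescaled in the Euclidean norm, whatever [p] and [q] are, because it is to
    become a column of a unitary matrix. *)
Lemma opnorm_attained_unit k l (A : 'M[C]_(k, l.+1)) (p q : \bar R) : (0 < p)%E -> (0 < q)%E ->
  exists v, [/\ mxF b v, l2 v = 1 & lpnorm q (A *m v) = opnorm b p q A * lpnorm p v].
Proof.
move=> p0 q0; have [[x [xF x0 xE]] _] := opnorm_attained b A (ltn0Sn l) p0 q0.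
have l0 : l2 x != 0 by rewrite gt_eqF// lpnorm_gt0// lte_fin.
have lp : cabs (l2 x)^-1%:C = (l2 x)^-1 by rewrite cabs_real ger0_norm// invr_ge0 lpnorm_ge0.
exists ((l2 x)^-1%:C *: x); split; first by apply: mxFZ => //; exact: inF_real.
  by rewrite lpnormZ ?lte_fin// lp mulVf.
by rewrite -scalemxAr !lpnormZ// xE mulrCA.
Qed.

Lemma opnorm_ge0 k l (A : 'M[C]_(k, l.+1)) (p q : \bar R) : (0 < p)%E -> (0 < q)%E ->
  0 <= opnorm b p q A.
Proof.
move=> p0 q0; have [[x [xF x0 xE]] _] := opnorm_attained b A (ltn0Sn l) p0 q0.
by rewrite -(pmulr_lge0 _ (lpnorm_gt0 p0 x0)) -xE lpnorm_ge0.
Qed.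

Lemma svd_step_top k l (A : 'M[C]_(k.+1, l.+1)) u v :
  (forall A' : 'M[C]_(k, l), mxF b A' -> has_svd A') ->
  mxF b A -> mxF b u -> mxF b v -> l2 u = 1 -> l2 v = 1 ->
  A *m v = (opnorm b 2%:E 2%:E A)%:C *: u ->
  exists U S V, [/\ svd_of A U S V, col 0 U = u, col 0 V = v &
    S 0 0 = (opnorm b 2%:E 2%:E A)%:C].
Proof.
move=> IH AF uF vF u1 v1 Av; apply: svd_step => //.
  by apply: opnorm_ge0; rewrite lte_fin.
by apply: (opnorm_attained b A _ _ _).2; rewrite ?lte_fin.
Qed.

(** Induction on the number of rows, with the number of columns free. A maximiser of the Euclidean
    quotient is the right singular vector, and its normalised image the left one. *)
Lemma svd_exists k l (A : 'M[C]_(k, l)) : mxF b A -> has_svd A.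
Proof.
have triv p q (M : 'M[C]_(p, q)) : M = 0 -> has_svd M.
  have one h : (1%:M : 'M[C]_h) \is unitarymx.
    by apply/unitarymxP; rewrite trmx1 map_mx1 mulmx1.
  move=> ->; exists 1%:M, 0, 1%:M; split; first by split=> //; exact: mxF_scalar.
  by split; [move=> i j; rewrite mxE | rewrite mulmx0 mul0mx].
elim: k l A => [|k IH] [|l] A AF; [exact/triv/flatmx0|exact/triv/flatmx0|exact/triv/thinmx0|].
have t0 : (0 < 2%:E :> \bar R)%E by rewrite lte_fin.
have [v [vF v1 Av]] := opnorm_attained_unit A t0 t0.
rewrite v1 mulr1 in Av; set s := opnorm _ _ _ _ in Av.
suff [u [uF u1 uE]] : exists u, [/\ mxF b u, l2 u = 1 & A *m v = s%:C *: u].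
  have [U [S [V [h _ _ _]]]] := svd_step_top (IH l) AF uF vF u1 v1 uE.
  by exists U, S, V.
(* If the norm is 0, the image of [v] vanishes and any unit vector serves as [u]. *)
have [s0|s0] := eqVneq s 0.
  exists (delta_mx 0 0); split; [exact: mxF_delta|exact: l2_delta|].
  by rewrite s0 scale0r (@lpnorm_eq0 _ _ 2%:E (A *m v))// Av.
exists (s^-1%:C *: (A *m v)); split.
- by apply: mxFZ; [exact: inF_real|exact: mxFM].
- rewrite lpnormZ// Av cabs_real ger0_norm ?mulVf// invr_ge0; exact: opnorm_ge0.
- by rewrite scalerA -rmorphM divff// scale1r.
Qed.

(** Column [j] of [V] is a unit vector whose image has the length of column [j] of [S], which is at
    least the modulus of each entry of that column. *)
Lemma svd_entry_le_opnorm k l (A : 'M[C]_(k, l.+1)) U S V i j :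
  svd_of A U S V -> S i j <= (opnorm b 2%:E 2%:E A)%:C.
Proof.
move=> [[UF VF Uu Vu] [Sd AE]].
have t0 : (0 < 2%:E :> \bar R)%E by rewrite lte_fin.
have Ae : A *m col j V = U *m col j S.
  by rewrite AE !colE mulmxA -(mulmxA _ _ V) unitarymx_mulVmx// mulmx1 mulmxA.
rewrite -(ger0_norm (Sd i j).1) cabsE lecR.
have -> : S i j = col j S i 0 by rewrite mxE.
apply: le_trans (cabs_le_l2 _ _) _; rewrite -(l2_unitary _ Uu) -Ae.
have := (opnorm_attained b A (ltn0Sn l) t0 t0).2 (col j V) (mxF_col j VF).
by rewrite [l2 (col j V)]l2_col_unitary// mulr1.
Qed.

(** Unitary factors preserve the Euclidean norm, so only [S] matters, and it acts on each coordinate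
    by a scalar of modulus at most [sigma]. *)
Lemma l2_svd_le k l (A : 'M[C]_(k.+1, l.+1)) U S V (sigma : R) :
  svd_of A U S V -> (forall i j, S i j <= sigma%:C) ->
  forall x, l2 (A *m x) <= sigma * l2 x.
Proof.
move=> [[UF VF Uu Vu] [Sd AE]] Smax x; rewrite AE -!mulmxA l2_unitary//.
have Vau : V ^t* \is unitarymx by rewrite trmxC_unitary.
rewrite -(l2_unitary x Vau); set y := _ *m x.
have s0 : 0 <= sigma by rewrite -ler0c; exact: le_trans (Sd 0 0).1 (Smax 0 0).
have L0 : 0 <= l2 y by exact: lpnorm_ge0.
rewrite -(@ler_pXn2r _ 2) ?nnegrE ?lpnorm_ge0 ?mulr_ge0// exprMn !l2_sqr.
have Sle i j : cabs (S i j) <= sigma.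
  by rewrite -lecR -cabsE (ger0_norm (Sd i j).1).
(* At most one term of row [i] survives, so the square of the sum is the sum of the squares; none
   survives when [i] lies beyond the last column. *)
have rowE (i : 'I_k.+1) : cabs ((S *m y) i 0) ^+ 2 =
    \sum_(j < l.+1) cabs (S i j * y j 0) ^+ 2.
  rewrite mxE; have [il|il] := ltnP i l.+1; last first.
    have z j : S i j = 0 by apply: (Sd i j).2; rewrite gtn_eqF// (leq_trans _ il)// ltnS.
    by rewrite !big1 ?cabs0 ?expr0n// => j _; rewrite z mul0r ?cabs0 ?expr0n.
  have z j : j != Ordinal il -> S i j = 0.
    by move=> ji; apply: (Sd i j).2; apply: contra_neq ji => ij; exact: val_inj.
  have zy j : j != Ordinal il -> S i j * y j 0 = 0 by move=> /z ->; exact: mul0r.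
  rewrite (bigD1 (Ordinal il) isT) /= big1 => [|j /zy]; last exact.
  rewrite [RHS](bigD1 (Ordinal il) isT) /= big1 => [|j /zy ->]; last by rewrite cabs0 expr0n.
  by rewrite !addr0.
under eq_bigr do rewrite rowE.
(* Once the sums are exchanged, at most one term survives in each column too, and the bound is
   checked for each coordinate of [y]. *)
rewrite exchange_big mulr_sumr /=; apply: ler_sum => j _.
have cz : 0 <= sigma ^+ 2 * cabs (y j 0) ^+ 2 by rewrite mulr_ge0 ?sqr_ge0.
have [jk|jk] := ltnP j k.+1; last first.
  rewrite big1// => i _; rewrite (Sd i j).2 ?mul0r ?cabs0 ?expr0n//.
  by rewrite ltn_eqF// (leq_trans _ jk).
rewrite (bigD1 (Ordinal jk))//= big1 ?addr0 => [|i ij]; last first.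
  rewrite (Sd i j).2 ?mul0r ?cabs0 ?expr0n//.
by rewrite cabsM exprMn ler_wpM2r ?sqr_ge0// ler_sqr ?nnegrE ?cabs_ge0.
Qed.

Lemma KsetZ e k (c : C) (x : 'cV[C]_k) : Kset e x -> Kset e (c *: x).
Proof.
rewrite /Kset; case: ifP => _; first by move=> h i j; rewrite !mxE !normrM (h i j).
by case: ifP => _ // h i j; rewrite !mxE !mulf_eq0 !negb_or => /andP[_ ?] /andP[_]; exact: h.
Qed.

(** Supplies singular vectors when the norm is 0. The first basis vector serves unless [e] is 1,
    where the normalised all-ones vector is taken. *)
Lemma Kset_unit e k : exists u : 'cV[C]_k.+1, [/\ mxF b u, l2 u = 1 & Kset e u].
Proof.
have [e1|e1] := boolP (e == 1); last first.
  exists (delta_mx 0 0); split; [exact: mxF_delta|exact: l2_delta|].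
  have h (i : 'I_k.+1) : (delta_mx 0 0 : 'cV[C]_k.+1) i 0 != 0 -> i = 0.
    by rewrite mxE eqxx andbT; case: (eqVneq i 0) => //; rewrite eqxx.
  by rewrite /Kset (negPf e1); case: ifP => _ // i j /h -> /h ->.
pose o : 'cV[C]_k.+1 := const_mx 1.
have o0 : 0 < l2 o.
  by apply: lpnorm_gt0; rewrite ?lte_fin//; apply/cV0Pn; exists 0; rewrite mxE oner_eq0.
exists ((l2 o)^-1%:C *: o); split.
- by apply: mxFZ => [|i j]; [exact: inF_real|rewrite mxE].
- by rewrite lpnormZ ?lte_fin// cabs_real ger0_norm ?mulVf ?gt_eqF// invr_ge0 ltW.
- by apply: KsetZ; rewrite /Kset e1 => i j; rewrite !mxE.
Qed.

End Completion.

(** * Equality in the norm bound and its characterisation by singular vectors *)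

Theorem theorem2 (R : realType) (isreal : bool) (n m : nat)
  (hn : (0 < n)%N) (hm : (0 < m)%N) (A : 'M[R[i]]_(n, m)) (r s : \bar R) :
  (1%:E <= r)%E -> (1%:E <= s)%E -> mxF isreal A ->
  (opnorm isreal r s A =
     (m%:R `^ pospart (2^-1 - einv r)) * (n%:R `^ pospart (einv s - 2^-1))
     * opnorm isreal 2%:E 2%:E A
   <->
   exists (U : 'M[R[i]]_n) (S : 'M[R[i]]_(n, m)) (V : 'M[R[i]]_m),
     [/\ mxF isreal U, mxF isreal V, U \is unitarymx & V \is unitarymx] /\
     nonneg_diag S /\ A = U *m S *m V ^t* /\
     [/\ Kset (sgn2m s) (col (Ordinal hn) U),
         Kset (- sgn2m r) (col (Ordinal hm) V) &
         forall i j, S i j <= S (Ordinal hn) (Ordinal hm)]).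
Proof.
move=> r1 s1 AF.
have [r0 s0] : (0 < r)%E /\ (0 < s)%E by split; apply: lt_le_trans; [|exact: r1| |exact: s1].
case: n m hn hm A AF => [//|n] [//|m] hn hm A AF.
have -> : Ordinal hn = 0 by exact: val_inj.
have -> : Ordinal hm = 0 by exact: val_inj.
have t0 : (0 < 2%:E :> \bar R)%E by rewrite lte_fin.
set beta := m.+1%:R `^ _; set alpha := n.+1%:R `^ _.
have b0 : 0 < beta by rewrite powR_gt0.
have a0 : 0 < alpha by rewrite powR_gt0.
have [_ le2] := opnorm_attained isreal A (ltn0Sn m) t0 t0.
have sig0 : 0 <= opnorm isreal 2%:E 2%:E A by exact: opnorm_ge0.
have [[x [xF x0 xE]] lers] := opnorm_attained isreal A (ltn0Sn m) r0 s0.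
(* The chain of three inequalities, the positive factor [alpha] being cancelled after the first. *)
have le_main z : mxF isreal z ->
    lpnorm s (A *m z) <= beta * alpha * opnorm isreal 2%:E 2%:E A * lpnorm r z.
  move=> zF; apply: le_trans (lpnorm_le_l2 (A *m z) s1).1 _; rewrite -/alpha.
  rewrite (mulrC beta) -!mulrA (mulrCA beta) ler_pM2l//.
  apply: le_trans (le2 _ zF) _; apply: ler_wpM2l => //.
  exact: (l2_le_lpnorm z r1).1.
split=> [opE|[U [S [V [UVP [Sd [AE [Ku Kv Smax]]]]]]]].
  (* A top pair of singular vectors in the prescribed sets suffices: it extends to a decomposition
     whose corner entry is the Euclidean operator norm, which bounds every other entry. *)
  suff [u [v [uF vF [u1 v1] Av [Ku Kv]]]] : exists u v, [/\ mxF isreal u, mxF isreal v,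
      lpnorm 2%:E u = 1 /\ lpnorm 2%:E v = 1,
      A *m v = (opnorm isreal 2%:E 2%:E A)%:C *: u &
      Kset (sgn2m s) u /\ Kset (- sgn2m r) v].
    have [U [S [V [h Uc Vc S00]]]] :=
      svd_step_top (fun A' => @svd_exists _ _ _ _ A') AF uF vF u1 v1 Av.
    have [UVP [Sd AE]] := h; exists U, S, V.
    split; [exact: UVP|split; [exact: Sd|split; [exact: AE|]]].
    split; [by rewrite Uc|by rewrite Vc|move=> i j].
    by rewrite S00; exact: svd_entry_le_opnorm h.
  (* If the norm is 0, every vector over the field is annihilated, and any unit vectors of the two
     sets will do. *)
  have [sz|sN] := eqVneq (opnorm isreal 2%:E 2%:E A) 0.
    have [u [uF u1 uK]] := @Kset_unit R isreal (sgn2m s) n.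
    have [v [vF v1 vK]] := @Kset_unit R isreal (- sgn2m r) m.
    exists u, v; split; [by []|by []|by []| |by []].
    rewrite sz scale0r; apply: (@lpnorm_eq0 _ _ 2%:E _ t0).
    by apply/le_anti; rewrite lpnorm_ge0 andbT (le_trans (le2 _ vF))// sz mul0r.
  have [v [vF v1 vE]] := opnorm_attained_unit isreal A r0 s0.
  set sigma := opnorm _ _ _ _ in sig0 le2 opE le_main sN *.
  have sg0 : 0 < sigma by rewrite lt_neqAle eq_sym sN.
  have [hs Ks] := lpnorm_le_l2 (A *m v) s1.
  have [hr Kr] := l2_le_lpnorm v r1.
  have h2 := le2 _ vF.
  rewrite -/alpha in hs Ks; rewrite -/beta in hr Kr.
  rewrite v1 in hr Kr h2; rewrite mulr1 in h2; rewrite opE in vE.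
  (* For the maximiser [v] both ends of the chain agree, so every inequality in it is an equality;
     [alpha] and [sigma] are positive and cancel. *)
  have h3 : alpha * lpnorm 2%:E (A *m v) <= alpha * sigma by rewrite ler_pM2l.
  have h4 : alpha * sigma <= alpha * sigma * (beta * lpnorm r v).
    by rewrite ler_pMr// mulr_gt0.
  have e5 : beta * alpha * sigma * lpnorm r v = alpha * sigma * (beta * lpnorm r v).
    by rewrite (mulrC beta) -!mulrA (mulrCA beta).
  rewrite e5 in vE.
  have Av : lpnorm 2%:E (A *m v) = sigma.
    apply: (mulfI (lt0r_neq0 a0)); apply/le_anti; rewrite h3/=.
    by rewrite (le_trans h4)// -vE.
  have Kv : 1 = beta * lpnorm r v.
    apply: (mulfI (lt0r_neq0 (mulr_gt0 a0 sg0))); apply/le_anti.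
    by rewrite mulr1 h4/= -vE (le_trans hs).
  exists (sigma^-1%:C *: (A *m v)), v; split=> //.
  - by apply: mxFZ; [exact: inF_real|exact: mxFM].
  - by rewrite lpnormZ// Av cabs_real ger0_norm ?mulVf// invr_ge0.
  - by rewrite scalerA -rmorphM divff// scale1r.
  (* [Ks] and [Kr] turn these equalities into membership, which survives the rescaling of
     [A *m v]. *)
  - split; last exact/Kr.
    by apply: KsetZ; apply/Ks; rewrite vE -Kv mulr1 Av.
have [UF VF Uu Vu] := UVP.
have svdA : svd_of isreal A U S V by [].
(* A nonnegative complex number is real, so the corner entry comes from a real [sg]. *)
have S0r : S 0 0 = (complex.Re (S 0 0))%:C.
  by rewrite RRe_real// ger0_real// (Sd 0 0).1.
set sg := complex.Re (S 0 0) in S0r.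
have lesg : forall z, lpnorm 2%:E (A *m z) <= sg * lpnorm 2%:E z.
  by apply: (l2_svd_le svdA) => i j; rewrite -S0r.
have sg0 : 0 <= sg by rewrite -ler0c -S0r (Sd 0 0).1.
have Av : A *m col 0 V = sg%:C *: col 0 U.
  rewrite AE !colE mulmxA -(mulmxA _ _ V) unitarymx_mulVmx// mulmx1.
  rewrite -mulmxA -colE scalemxAr; congr (_ *m _).
  apply/colP => i; rewrite !mxE andbT.
  by have [->|i0] := eqVneq i 0; rewrite ?mulr1// mulr0 (Sd i 0).2.
(* Membership of the first columns in their sets makes the two norm comparisons equalities. *)
have Ku1 := (lpnorm_le_l2 (col 0 U) s1).2.2 Ku.
have Kv1 := (l2_le_lpnorm (col 0 V) r1).2.2 Kv.
rewrite !l2_col_unitary// -/alpha -/beta in Ku1 Kv1.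
(* One inequality follows from [lesg] at a Euclidean maximiser, the other from the first column of
   [V]. *)
have opsg : opnorm isreal 2%:E 2%:E A = sg.
  apply/le_anti/andP; split.
    have [z [zF z1 zE]] := opnorm_attained_unit isreal A t0 t0.
    by have := lesg z; rewrite zE z1 !mulr1.
  have := le2 _ (mxF_col 0 VF); rewrite Av lpnormZ// !l2_col_unitary// !mulr1.
  by rewrite cabs_real ger0_norm.
(* The upper bound is [le_main] at the maximiser [x], whose positive norm cancels. For the lower
   bound the first column of [V] is tested: its [r]-norm is the inverse of [beta], and its image has
   [s]-norm [sg * alpha]. *)
rewrite opsg in le_main *; apply/le_anti/andP; split.
  by rewrite -(ler_pM2r (lpnorm_gt0 r0 x0)) -xE le_main.
have := lers _ (mxF_col 0 VF); rewrite Av lpnormZ// cabs_real (ger0_norm sg0) Ku1 mulr1.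
move=> /(ler_wpM2l (ltW b0)); rewrite (mulrCA beta (opnorm _ _ _ _)) -Kv1 mulr1.
by rewrite (mulrC sg) mulrA.
Qed.
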